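(* Let $\{\mathcal{R}_A\}$ be one of the zero-divisor functorial families $\{=_A\}$, $\{\approx_A\}$ or $\{\sim_A\}$, and let $\zeta$ be its associated zero-divisor functor. Then, for all rings $A_1,\dots,A_n$, we have $\zeta(A_1\times\cdots\times A_n)\simeq\zeta(A_1)\times\cdots\times\zeta(A_n)$ as graphs.
   Context: All rings are commutative and unitary. On a ring $A$: $=_A$ is equality; $a\approx_A b$ iff there is a unit $u\in A^\times$ with $a=ub$; $a\sim_A b$ iff $(a)=(b)$ as ideals. A graph is a set $V$ with a symmetric binary relation $E$ on $V$ (loops allowed); graph isomorphisms are bijections of vertices preserving adjacency in both directions. The product $G_1\times G_2$ has vertex set $V(G_1)\times V(G_2)$, with two pairs adjacent iff both components are adjacent. For a zero-divisor functorial family $\{\mathcal{R}_A\}$ (each of the three above is one), $\zeta(A)$ is the graph with vertex set $A/\mathcal{R}_A$ in which $[a],[b]$ are adjacent iff $ab=0$ (well defined), and $\zeta(f)([a])=[f(a)]$ for a ring homomorphism $f$. *)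

(* Defs.v *)
From HB Require Import structures.
From mathcomp Require Import all_boot all_algebra.
From mathcomp Require Import boolp classical_sets.

Set Implicit Arguments.
Unset Strict Implicit.
Unset Printing Implicit Defensive.

Import GRing.Theory.
Local Open Scope ring_scope.
Local Open Scope quotient_scope.
Local Open Scope classical_set_scope.

(* Commutative unitary rings are [comPzRingType]s: the zero ring is allowed.  *)

(* The library only has the ring structure on non-dependent finite functions; *)
(* this is the componentwise ring structure on A_1 x ... x A_n.               *)
Section ProductRing.
Variables (I : finType) (A : I -> comPzRingType).
Local Notation prodA := {dffun forall i : I, A i}.
Implicit Types f g h : prodA.

Definition dffun_zero : prodA := [ffun i => 0 : A i].
Definition dffun_opp f : prodA := [ffun i => - f i : A i].
Definition dffun_add f g : prodA := [ffun i => f i + g i : A i].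
Definition dffun_one : prodA := [ffun i => 1 : A i].
Definition dffun_mul f g : prodA := [ffun i => f i * g i : A i].

Fact dffun_addA : associative dffun_add.
Proof. by move=> f g h; apply/ffunP => i; rewrite !ffunE addrA. Qed.
Fact dffun_addC : commutative dffun_add.
Proof. by move=> f g; apply/ffunP => i; rewrite !ffunE addrC. Qed.
Fact dffun_add0 : left_id dffun_zero dffun_add.
Proof. by move=> f; apply/ffunP => i; rewrite !ffunE add0r. Qed.
Fact dffun_addN : left_inverse dffun_zero dffun_opp dffun_add.
Proof. by move=> f; apply/ffunP => i; rewrite !ffunE addNr. Qed.

HB.instance Definition _ := GRing.isZmodule.Build prodA
  dffun_addA dffun_addC dffun_add0 dffun_addN.

Fact dffun_mulA : associative dffun_mul.
Proof. by move=> f g h; apply/ffunP => i; rewrite !ffunE mulrA. Qed.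
Fact dffun_mulC : commutative dffun_mul.
Proof. by move=> f g; apply/ffunP => i; rewrite !ffunE mulrC. Qed.
Fact dffun_mul1 : left_id dffun_one dffun_mul.
Proof. by move=> f; apply/ffunP => i; rewrite !ffunE mul1r. Qed.
Fact dffun_mulDl : left_distributive dffun_mul dffun_add.
Proof. by move=> f g h; apply/ffunP => i; rewrite !ffunE mulrDl. Qed.

HB.instance Definition _ := GRing.Zmodule_isComPzRing.Build prodA
  dffun_mulA dffun_mulC dffun_mul1 dffun_mulDl.

Lemma dffun_mulE f g i : (f * g) i = f i * g i.
Proof. exact: ffunE. Qed.
Lemma dffun_0E i : (0 : prodA) i = 0.
Proof. exact: ffunE. Qed.
Lemma dffun_1E i : (1 : prodA) i = 1.
Proof. exact: ffunE. Qed.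

End ProductRing.

Record graph := Graph {
  vertex :> Type;
  adj : vertex -> vertex -> Prop;
  adj_sym : forall x y, adj x y -> adj y x
}.

Definition graph_iso (G H : graph) : Prop :=
  exists f : G -> H, bijective f /\ forall x y, adj x y <-> adj (f x) (f y).

Notation "G ≃g H" := (graph_iso G H) (at level 70, no associativity).

Section GraphProduct.
Variables (I : Type) (G : I -> graph).

Definition gprod_adj (x y : forall i, G i) : Prop := forall i, adj (x i) (y i).

Fact gprod_adj_sym x y : gprod_adj x y -> gprod_adj y x.
Proof. by move=> xy i; apply: adj_sym. Qed.

Definition gprod : graph := Graph gprod_adj_sym.

End GraphProduct.

Section Relations.
Variable A : comPzRingType.
Implicit Types a b u : A.

(* [GRing.unit] requires a nonzero ring with a given inverse operation.       *)
Definition is_unit u : Prop := exists v : A, u * v = 1.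

Definition associated a b : Prop := exists2 u, is_unit u & a = u * b.

Definition principal_ideal a : set A := [set r * a | r in [set: A]].

Definition same_ideal a b : Prop := principal_ideal a = principal_ideal b.

End Relations.

Inductive zd_family := ZdEq | ZdAssoc | ZdIdeal.

Section ZeroDivisorGraph.
Variables (F : zd_family) (A : comPzRingType).
Implicit Types a b c : A.

Definition zd_rel : A -> A -> Prop :=
  match F with
  | ZdEq => @eq A
  | ZdAssoc => @associated A
  | ZdIdeal => @same_ideal A
  end.

Fact zd_rel_refl a : zd_rel a a.
Proof.
rewrite /zd_rel; case: F => //.
by exists 1; rewrite ?mul1r //; exists 1; rewrite mulr1.
Qed.

Fact zd_rel_sym a b : zd_rel a b -> zd_rel b a.
Proof.
rewrite /zd_rel; case: F => [->|[u [v uv] ->]|] //.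
exists v; first by exists u; rewrite mulrC.
by rewrite mulrA [v * u]mulrC uv mul1r.
Qed.

Fact zd_rel_trans a b c : zd_rel a b -> zd_rel b c -> zd_rel a c.
Proof.
rewrite /zd_rel; case: F => [|[u [v uv] ->] [u' [v' uv'] ->]|].
- exact: etrans.
- exists (u * u'); last by rewrite mulrA.
  by exists (v * v'); rewrite mulrACA uv uv' mulr1.
- exact: etrans.
Qed.

Definition zd_relb : rel A := fun a b => `[< zd_rel a b >].

Fact zd_relb_refl : reflexive zd_relb.
Proof. by move=> a; apply/asboolP/zd_rel_refl. Qed.
Fact zd_relb_sym : symmetric zd_relb.
Proof. by move=> a b; apply/asboolP/asboolP => /zd_rel_sym. Qed.
Fact zd_relb_trans : transitive zd_relb.
Proof.
move=> b a c /asboolP ab /asboolP bc; apply/asboolP; exact: zd_rel_trans bc.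
Qed.

Canonical zd_equiv : equiv_rel A :=
  EquivRel zd_relb zd_relb_refl zd_relb_sym zd_relb_trans.

(* A / R_A *)
Definition zd_quot : Type := {eq_quot zd_equiv}.

Definition zd_class a : zd_quot := \pi_({eq_quot zd_equiv}) a.

Lemma zd_classP a b : zd_class a = zd_class b <-> zd_rel a b.
Proof.
split=> [/eqP|ab]; last by apply/eqP; rewrite eqmodE; apply/asboolP.
by rewrite eqmodE => /asboolP.
Qed.

Definition zd_adj (x y : zd_quot) : Prop :=
  exists a b, [/\ x = zd_class a, y = zd_class b & a * b = 0].

Fact zd_adj_sym x y : zd_adj x y -> zd_adj y x.
Proof. by move=> [a [b [-> -> ab]]]; exists b, a; rewrite mulrC. Qed.

Definition zeta : graph := Graph zd_adj_sym.

Lemma zd_rel_mul0 a a' b : zd_rel a a' -> a * b = 0 -> a' * b = 0.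
Proof.
rewrite /zd_rel; case: F => [-> //||].
- move=> [u [v uv] ->] ab.
  by rewrite -[a']mul1r -uv [u * v]mulrC -!mulrA mulrA -mulrA [u * _]mulrA ab mulr0.
- move=> aa' ab; have: principal_ideal a' a' by exists 1; rewrite ?mul1r.
  by rewrite -aa' => -[r _ <-]; rewrite -mulrA ab mulr0.
Qed.

(* Adjacency in zeta does not depend on the choice of representatives. *)
Lemma zeta_adjE a b : @adj zeta (zd_class a) (zd_class b) <-> a * b = 0.
Proof.
split=> [[a' [b' [/esym/zd_classP aa' /esym/zd_classP bb' ab']]]|ab].
  apply: (zd_rel_mul0 aa'); rewrite mulrC.
  by apply: (zd_rel_mul0 bb'); rewrite mulrC.
by exists a, b.
Qed.

End ZeroDivisorGraph.

(* Main.v *)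
Require Import Defs.
From HB Require Import structures.
From mathcomp Require Import all_boot all_algebra.
From mathcomp Require Import boolp classical_sets.

(** The isomorphism sends the class of a tuple [a] to the tuple of the classes
    of its entries.  It exists and is injective because each of the three
    relations holds in a product of rings exactly when it holds in every
    factor ([zd_rel_dffunP]): equality, invertibility and divisibility are all
    componentwise, since the witnesses chosen in the factors assemble into one
    witness in the product ([dffun_choice]).  The same assembling of
    representatives gives surjectivity.  Finally, a product of two tuples
    vanishes iff it vanishes in every factor, which is adjacency in the product
    graph. *)

Set Implicit Arguments.
Unset Strict Implicit.
Unset Printing Implicit Defensive.

Import GRing.Theory.
Local Open Scope ring_scope.
Local Open Scope quotient_scope.

Lemma same_idealP (A : comPzRingType) (a b : A) :
  same_ideal a b <-> (exists r, a = r * b) /\ (exists r, b = r * a).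
Proof.
split=> [ab|[[r ->] [s bE]]].
  have gen (c : A) : principal_ideal c c by exists 1; rewrite ?mul1r.
  split.
    by have := gen a; rewrite ab => -[r _ <-]; exists r.
  by have := gen b; rewrite -ab => -[r _ <-]; exists r.
apply/seteqP; split=> c [t _ <-]; first by exists (t * r); rewrite ?mulrA.
by exists (t * s); rewrite // -mulrA -bE.
Qed.

Lemma zd_class_surj (F : zd_family) (A : comPzRingType) (x : zeta F A) :
  exists a, x = zd_class F a.
Proof. by exists (repr (x : {eq_quot zd_equiv F A})); rewrite /zd_class reprK. Qed.

Section Product.
Variables (I : finType) (A : I -> comPzRingType).
Local Notation prodA := {dffun forall i : I, A i}.
Implicit Types a b : prodA.

Lemma dffun_choice (P : forall i, A i -> Prop) :
  (forall i, exists r, P i r) -> exists r : prodA, forall i, P i (r i).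
Proof.
move=> exP; exists [ffun i => sval (cid (exP i)) : A i] => i.
by rewrite ffunE; exact: (svalP (cid (exP i))).
Qed.

Lemma dffun_mul0P a b : a * b = 0 <-> forall i, a i * b i = 0.
Proof.
split=> [ab i|ab]; first by rewrite -dffun_mulE ab dffun_0E.
by apply/ffunP => i; rewrite dffun_mulE dffun_0E ab.
Qed.

Lemma dffun_is_unitP a : is_unit a <-> forall i, is_unit (a i).
Proof.
split=> [[v av] i|/dffun_choice[v av]].
  by exists (v i); rewrite -dffun_mulE av dffun_1E.
by exists v; apply/ffunP => i; rewrite dffun_mulE dffun_1E av.
Qed.

Lemma dffun_dvdP a b :
  (exists r, a = r * b) <-> forall i, exists r, a i = r * b i.
Proof.
split=> [[r ->] i|/dffun_choice[r ab]]; first by exists (r i); rewrite dffun_mulE.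
by exists r; apply/ffunP => i; rewrite dffun_mulE ab.
Qed.

(** For association the chosen multipliers form a unit because inverses
    assemble as well; for ideals, equality is divisibility both ways, and a
    factor can be chosen separately in each ring. *)
Lemma zd_rel_dffunP (F : zd_family) a b :
  zd_rel F a b <-> forall i, zd_rel F (a i) (b i).
Proof.
rewrite /zd_rel; case: F.
- by split=> [-> //|ab]; apply/ffunP.
- split=> [[u /dffun_is_unitP uU ->] i|ab].
    by exists (u i); rewrite ?dffun_mulE.
  have /dffun_choice[u uP] i : exists u, is_unit u /\ a i = u * b i.
    by have [u uU ->] := ab i; exists u.
  exists u; first by apply/dffun_is_unitP => i; have [] := uP i.
  by apply/ffunP => i; rewrite dffun_mulE; have [] := uP i.
- split=> [/same_idealP[/dffun_dvdP ab /dffun_dvdP ba] i|ab].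
    by apply/same_idealP.
  by apply/same_idealP; split; apply/dffun_dvdP => i;
    have /same_idealP[] := ab i.
Qed.

Theorem zeta_prod_iso (F : zd_family) :
  zeta F prodA ≃g gprod (fun i => zeta F (A i)).
Proof.
pose rep (x : zeta F prodA) : prodA := sval (cid (zd_class_surj x)).
have repK x : zd_class F (rep x) = x by rewrite -(svalP (cid (zd_class_surj x))).
have exrep (y : gprod (fun i => zeta F (A i))) :
    exists a : prodA, forall i, y i = zd_class F (a i).
  apply: (dffun_choice (P := fun i r => y i = zd_class F r)) => i.
  exact: zd_class_surj.
pose f x : gprod (fun i => zeta F (A i)) := fun i => zd_class F (rep x i).
pose g y : zeta F prodA := zd_class F (sval (cid (exrep y))).
have gP y i : y i = zd_class F (sval (cid (exrep y)) i).
  exact: (svalP (cid (exrep y))).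
exists f; split.
  exists g => [x|y].
    rewrite -[RHS]repK; apply/zd_classP/zd_rel_dffunP => i.
    by apply/zd_classP; rewrite -gP.
  apply: functional_extensionality_dep => /= i; rewrite [RHS]gP.
  apply/zd_classP; move: i; apply/zd_rel_dffunP/zd_classP.
  exact: repK.
move=> x y; rewrite -{1}[x]repK -{1}[y]repK.
split=> [/zeta_adjE/dffun_mul0P xy i|xy]; first exact/zeta_adjE.
by apply/zeta_adjE/dffun_mul0P => i; apply/zeta_adjE; exact: xy.
Qed.

End Product.

Theorem corollary3p12 (F : zd_family) (n : nat) (A : 'I_n -> comPzRingType) :
  zeta F {dffun forall i : 'I_n, A i} ≃g gprod (fun i : 'I_n => zeta F (A i)).
Proof. exact: zeta_prod_iso. Qed.
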